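(* Let $a,b$ be integers with $1\le a<b$, and let $G$ be a graph of order $n\ge 3b(b+a+1)/a+7$. If $\rho(G)\ge\rho(H_{n,b})$, then $G$ has all fractional $[a,b]$-factors unless $G\cong H_{n,b}$.
   Context: All graphs are finite, undirected and simple. $\rho(G)$ denotes the spectral radius (largest eigenvalue of the adjacency matrix) of $G$. For graphs $G_1,G_2$, the join $G_1\nabla G_2$ is obtained from the disjoint union $G_1\cup G_2$ by adding all edges between $V(G_1)$ and $V(G_2)$. For integers $2\le b\le n-1$, $H_{n,b}:=K_{b-1}\nabla(K_1\cup K_{n-b})$. For a function $p:V(G)\to\mathbb{Z}^+$, a fractional $p$-factor of $G$ is (the spanning subgraph with edge set $\{e: w(e)>0\}$ of) a function $w:E(G)\to[0,1]$ such that $\sum_{e\in E_G(v)} w(e)=p(v)$ for every $v\in V(G)$, where $E_G(v)$ is the set of edges incident with $v$; $G$ has a fractional $p$-factor if such $w$ exists. For positive integers $a\le b$, $G$ has all fractional $[a,b]$-factors if $G$ has a fractional $p$-factor for every function $p:V(G)\to\mathbb{Z}^+$ with $a\le p(v)\le b$ for all $v\in V(G)$. *)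

(* Defs.v *)
From HB Require Import structures.
From mathcomp Require Import all_boot all_order all_algebra.
From mathcomp Require Import reals.
Set Implicit Arguments. Unset Strict Implicit. Unset Printing Implicit Defensive.
Import Order.TTheory GRing.Theory Num.Theory.
Local Open Scope ring_scope.

Definition simple_graph (n : nat) (G : rel 'I_n) : Prop :=
  symmetric G /\ irreflexive G.

Definition adjmx (R : realType) (n : nat) (G : rel 'I_n) : 'M[R]_n :=
  \matrix_(i, j) (G i j)%:R.

Definition spectral_radius (R : realType) (n : nat) (A : 'M[R]_n) (r : R) : Prop :=
  eigenvalue A r /\ (forall l : R, eigenvalue A l -> l <= r).

(* H_{n,b} = K_{b-1} \nabla (K_1 \cup K_{n-b}) on 'I_n:
   vertices 0..b-2 form K_{b-1}, vertex b-1 is the K_1,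
   vertices b..n-1 form K_{n-b}. *)
Definition Hnb (n b : nat) : rel 'I_n :=
  fun i j => (i != j) &&
    [|| (i < b.-1)%N, (j < b.-1)%N | (b <= i)%N && (b <= j)%N].

Definition isomorphic (n : nat) (G H : rel 'I_n) : Prop :=
  exists f : 'I_n -> 'I_n, bijective f /\ (forall i j, G i j = H (f i) (f j)).

(* Fractional p-factor: a weight on edges (encoded as a symmetric function
   on ordered pairs, only its values on edges matter) with values in [0,1]
   summing to p(v) over the edges at each vertex v. *)
Definition has_fractional_p_factor (R : realType) (n : nat) (G : rel 'I_n)
    (p : 'I_n -> nat) : Prop :=
  exists w : 'I_n -> 'I_n -> R,
    (forall i j, w i j = w j i) /\
    (forall i j, 0 <= w i j <= 1) /\
    (forall i, \sum_(j | G i j) w i j = (p i)%:R).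

Definition all_fractional_factors (R : realType) (n : nat) (G : rel 'I_n)
    (a b : nat) : Prop :=
  forall p : 'I_n -> nat,
    (forall v, (0 < p v)%N /\ (a <= p v <= b)%N) ->
    has_fractional_p_factor R G p.

Arguments Hnb n b : clear implicits.
Arguments adjmx R n G : clear implicits.

(* Main.v *)
(* By a bipartite degree-constrained-subgraph theorem and symmetrization, a missing
   fractional p-factor yields disjoint S, T with [a|S| - b|T| + sum_T d_(G-S) < 0].
   If some vertex has degree less than b, then G is, up to relabelling, a spanning subgraph
   of H_(n,b); a positive eigenvector of H_(n,b) then shows that rho(G) >= rho(H_(n,b))
   forces equality.  Otherwise |T| >= 2, and Hong's bound rho^2 <= 2m - n + 1 together with
   rho(H_(n,b)) >= n - 2 leaves at most n - 2 nonadjacent pairs, fewer than S and T produce. *)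
Require Import Defs.
From HB Require Import structures.
From mathcomp Require Import all_boot all_order all_algebra.
From mathcomp Require Import reals.
From mathcomp Require Import zify ring lra.
Import Order.TTheory GRing.Theory Num.Theory.
Local Open Scope ring_scope.

(** * Bipartite subgraphs with prescribed degrees *)

Definition edges {n : nat} (E : rel 'I_n) (X Y : {set 'I_n}) : int :=
  \sum_(i : 'I_n) \sum_(j : 'I_n) (E i j && (i \in X) && (j \in Y))%:R.

(** A cut condition: the columns in [Y] can receive at most [edges E X Y] from the rows in [X], and
    at most the total of [r] outside [X] from the other rows. The slack is the surplus of this
    capacity over the demand of [Y]. *)
Definition slack {n : nat} (E : rel 'I_n) (r c : 'I_n -> int) (X Y : {set 'I_n}) : int :=
  edges E X Y + \sum_i r i - \sum_(i in X) r i - \sum_(j in Y) c j.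

(* Submodularity of [edges] on the lattice with meet [(X :&: X', Y :|: Y')]; it is strict
   because the edge [(i0, j0)] lies in [X :\: X'] x [Y :\: Y']. *)
Lemma edges_uncross {n : nat} (E : rel 'I_n) (i0 j0 : 'I_n) (X Y X' Y' : {set 'I_n}) :
  E i0 j0 -> i0 \in X -> j0 \in Y -> i0 \notin X' -> j0 \notin Y' ->
  edges E (X :&: X') (Y :|: Y') + edges E (X :|: X') (Y :&: Y') <
  edges E X Y + edges E X' Y'.
Proof.
move=> e0 iX jY iX' jY'; rewrite /edges -!big_split /=.
under eq_bigr do rewrite -big_split /=.
under [ltRHS]eq_bigr do rewrite -big_split /=.
have H i j : (E i j && (i \in X :&: X') && (j \in Y :|: Y'))%:R
   + (E i j && (i \in X :|: X') && (j \in Y :&: Y'))%:R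
   <= (E i j && (i \in X) && (j \in Y))%:R + (E i j && (i \in X') && (j \in Y'))%:R :> int.
  by rewrite !inE; case: (E i j) (i \in X) (i \in X') (j \in Y) (j \in Y') => [] [] [] [] [].
rewrite (bigD1 i0) //= [ltRHS](bigD1 i0) //=.
apply: ltr_leD; last by apply: ler_sum => i _; apply: ler_sum.
rewrite (bigD1 j0) //= [ltRHS](bigD1 j0) //=.
apply: ltr_leD; last by apply: ler_sum.
by rewrite !inE e0 iX jY (negPf iX') (negPf jY').
Qed.

Lemma sum_setUI {n : nat} (r : 'I_n -> int) (X Y : {set 'I_n}) :
  \sum_(i in X :&: Y) r i + \sum_(i in X :|: Y) r i = \sum_(i in X) r i + \sum_(i in Y) r i.
Proof.
rewrite ![\sum_(i in _) _]big_mkcond -!big_split /=; apply: eq_bigr => i _.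
by rewrite !inE; case: (i \in X) (i \in Y) => [] [] //=; rewrite ?addr0 ?add0r.
Qed.

(* Induction on the number of edges: if neither deleting an edge nor putting it into [W]
   preserves the condition, then two tight pairs exist whose uncrossing has negative slack.
   The degrees are integers so that putting an edge into [W] never underflows. *)
Lemma degree_realization {n : nat} (E : rel 'I_n) (r c : 'I_n -> int) :
  \sum_i r i = \sum_i c i ->
  (forall X Y, 0 <= slack E r c X Y) ->
  exists W : rel 'I_n, [/\ forall i j, W i j -> E i j,
    forall i, \sum_j (W i j)%:R = r i & forall j, \sum_i (W i j)%:R = c j].
Proof.
have [k] := ubnP #|[set u : 'I_n * 'I_n | E u.1 u.2]|.
elim: k E r c => // k IH E r c leEk rc sl.
have [/existsP[[i0 j0] /= e0]|] := boolP [exists u : 'I_n * 'I_n, E u.1 u.2]; last first.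
  move=> /existsPn E0.
  have E0' i j : E i j = false by apply/negbTE/(E0 (i, j)).
  have eE X Y : edges E X Y = 0 by rewrite /edges big1 // => i _; rewrite big1 // => j _; rewrite E0'.
  (* Without edges, the slack is the total at the empty pair and its opposite at the full pair.
     Degrees with nonpositive partial sums and total zero then vanish, as a singleton and its
     complement show. *)
  have N0 : \sum_i r i = 0.
    have eT d : \sum_(i in [set: 'I_n]) d i = \sum_i d i :> int by apply: eq_bigl => i; rewrite inE.
    by have := sl set0 set0; have := sl setT setT; rewrite /slack !eE !big_set0 !eT -rc; set N : int := \sum_i r i; lia.
  have z (d : 'I_n -> int) i : (forall X : {set 'I_n}, \sum_(i in X) d i <= 0) -> \sum_i d i = 0 -> d i = 0 :> int.
    move=> H; rewrite (bigD1 i) //= => S.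
    have := H [set i]; have := H [set~ i]; rewrite big_set1.
    rewrite (eq_bigl (fun j => j != i)) => [|j]; last by rewrite !inE.
    by move=> T0 d0; apply/eqP; rewrite eq_le d0 -oppr_le0 (addr0_eq S).
  exists (fun _ _ => false); split => // i; rewrite big1 //; symmetry; apply: z => //.
  - by move=> X; have := sl X set0; rewrite /slack eE big_set0 add0r N0 sub0r subr0 oppr_ge0.
  - by move=> X; have := sl set0 X; rewrite /slack eE big_set0 add0r N0 subr0 sub0r oppr_ge0.
  - by rewrite -rc N0.
pose E' := [rel i j | E i j && ((i, j) != (i0, j0))].
have cardE' : (#|[set u : 'I_n * 'I_n | E' u.1 u.2]| < k)%N.
  rewrite ltnS in leEk; apply: leq_trans leEk; apply: proper_card; apply/properP; split.
    by apply/subsetP => -[i j]; rewrite !inE /= => /andP[].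
  by exists (i0, j0); rewrite !inE //= e0 eqxx.
have edgesE' X Y : edges E X Y = edges E' X Y + ((i0 \in X) && (j0 \in Y))%:R.
  rewrite /edges (bigD1 i0) //= (bigD1 j0) //= [in RHS](bigD1 i0) //= [in RHS](bigD1 j0) //=.
  rewrite e0 eqxx /= add0r -addrA addrC; congr (_ + _ + _).
  - by apply: eq_bigr => j jj; rewrite xpair_eqE (negPf jj) andbF andbT.
  - by apply: eq_bigr => i ii; apply: eq_bigr => j _; rewrite xpair_eqE (negPf ii) andbT.
pose r' i := r i - (i == i0)%:R; pose c' j := c j - (j == j0)%:R.
have sum1 (i1 : 'I_n) (P : pred 'I_n) : \sum_(i | P i) ((i == i1)%:R : int) = (P i1)%:R.
  rewrite big_mkcond (bigD1 i1) //= eqxx big1; last by move=> i /negPf ->; case: ifP.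
  by rewrite addr0; case: (P i1).
case: (boolP [exists u : {set 'I_n} * {set 'I_n}, slack E' r c u.1 u.2 < 0]); last first.
  move=> /existsPn H; have [|W [WE Wr Wc]] := IH E' r c cardE' rc.
    by move=> X Y; have := H (X, Y); rewrite /= -leNgt.
  by exists W; split=> // i j /WE /andP[].
move=> /existsP[[X Y] /= XY].
case: (boolP [exists u : {set 'I_n} * {set 'I_n}, slack E' r' c' u.1 u.2 < 0]); last first.
  move=> /existsPn H; have [||W [WE Wr Wc]] := IH E' r' c' cardE'.
  - by rewrite !sumrB rc !sum1.
  - by move=> X' Y'; have := H (X', Y'); rewrite /= -leNgt.
  have W0 : W i0 j0 = false by apply/negP => /WE /=; rewrite eqxx andbF.
  exists (fun i j => W i j || ((i, j) == (i0, j0))); split.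
  - by move=> i j /orP[/WE /andP[]|/eqP[-> ->]].
  - move=> i; rewrite -[r i](subrK (i == i0)%:R) -[r i - _]Wr.
    have [->|ii] := eqVneq i i0.
      rewrite (bigD1 j0) //= [in RHS](bigD1 j0) //= W0 eqxx add0r addrC; congr (_ + _).
      by apply: eq_bigr => j jj; rewrite xpair_eqE (negPf jj) andbF orbF.
    by rewrite addr0; apply: eq_bigr => j _; rewrite xpair_eqE (negPf ii) orbF.
  - move=> j; rewrite -[c j](subrK (j == j0)%:R) -[c j - _]Wc.
    have [->|jj] := eqVneq j j0.
      rewrite (bigD1 i0) //= [in RHS](bigD1 i0) //= W0 eqxx add0r addrC; congr (_ + _).
      by apply: eq_bigr => i ii; rewrite xpair_eqE (negPf ii) orbF.
    by rewrite addr0; apply: eq_bigr => i _; rewrite xpair_eqE (negPf jj) andbF orbF.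
(* Deletion lowers the slack, by one, only at pairs with [i0] in [X] and [j0] in [Y]; putting the
   edge into [W] lowers it, by one, only at pairs with [i0] outside [X'] and [j0] outside [Y'].
   Hence both failing pairs are tight for [E], and [(i0, j0)] makes their uncrossing strict. *)
move=> /existsP[[X' Y'] /= XY'].
pose sR (Z : {set 'I_n}) : int := \sum_(i in Z) r i.
pose sC (Z : {set 'I_n}) : int := \sum_(i in Z) c i.
pose N : int := \sum_i r i.
have slE Z Z' : 0 <= edges E' Z Z' + ((i0 \in Z) && (j0 \in Z'))%:R + N - sR Z - sC Z'.
  by rewrite -edgesE'; apply: sl.
have {}XY : edges E' X Y + N - sR X - sC Y < 0 := XY.
have {}XY' : edges E' X' Y' + (N - 1) - (sR X' - (i0 \in X')%:R) - (sC Y' - (j0 \in Y')%:R) < 0.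
  by move: XY'; rewrite /slack /r' /c' !sumrB !sum1.
have uR : sR (X :&: X') + sR (X :|: X') = sR X + sR X' := sum_setUI r X X'.
have uC : sC (Y :&: Y') + sC (Y :|: Y') = sC Y + sC Y' := sum_setUI c Y Y'.
have := edges_uncross E i0 j0 X Y X' Y' e0; rewrite !edgesE'.
have := slE X Y; have := slE X' Y'.
have := slE (X :&: X') (Y :|: Y'); have := slE (X :|: X') (Y :&: Y').
rewrite !inE; clearbody sR sC N; clear -uR uC XY XY'.
case: (i0 \in X) (j0 \in Y) (i0 \in X') (j0 \in Y') XY' => [] [] [] [] /=; lia.
Qed.

(** * Spectral radius: comparison of graphs and an upper bound *)

Lemma eigenvalue_adjmxP (R : realType) (n : nat) (G : rel 'I_n) (l : R) :
  symmetric G ->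
  reflect (exists2 y : 'I_n -> R, (forall i, \sum_j (G i j)%:R * y j = l * y i)
                                & exists i, y i != 0)
          (eigenvalue (adjmx R n G) l).
Proof.
move=> symG; apply: (iffP eigenvalueP) => [[v vE v0]|[y yE [i yi]]].
  exists (fun i => v ord0 i).
    move=> i; move/rowP: vE => /(_ i); rewrite !mxE => <-.
    by apply: eq_bigr => j _; rewrite !mxE mulrC symG.
  have [/existsP[i vi]|/existsPn H] := boolP [exists i, v ord0 i != 0]; first by exists i.
  by case/eqP: v0; apply/rowP => i; rewrite mxE; apply/eqP/negbNE/H.
exists (\row_j y j).
  apply/rowP => k; rewrite !mxE -yE; apply: eq_bigr => j _.
  by rewrite !mxE mulrC symG.
by apply: contra_neq yi => /rowP/(_ i); rewrite !mxE.
Qed.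

(* Pairing [|y|] with the positive eigenvector [x] forces equality in
   [mu |y| <= A_G |y| <= A_H |y|]; then [|y|] is a nonnegative eigenvector of
   [H], hence positive since [c] dominates [H]. *)
Lemma spectral_monotone_strict (R : realType) (n : nat) (G H : rel 'I_n)
    (x y : 'I_n -> R) (l m : R) (c : 'I_n) :
  symmetric H -> (forall i j, G i j -> H i j) ->
  (forall i, i != c -> H c i) ->
  (forall i, 0 < x i) -> (forall i, \sum_j (H i j)%:R * x j = l * x i) ->
  (forall i, \sum_j (G i j)%:R * y j = m * y i) -> (exists i, y i != 0) ->
  l <= m -> forall i j, G i j = H i j.
Proof.
move=> symH GH domc x0 xE yE [k yk] lm.
pose z i : R := `|y i|.
have z0 i : 0 <= z i by apply: normr_ge0.
pose d i : R := \sum_j (G i j)%:R * z j - m * z i.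
have d0 i : 0 <= d i.
  rewrite subr_ge0; apply: (@le_trans _ _ (`|m| * z i)).
    by rewrite ler_wpM2r // ler_norm.
  rewrite -normrM -yE (le_trans (ler_norm_sum _ _ _)) //.
  by apply: ler_sum => j _; rewrite normrM normr_nat.
pose e i : R := \sum_j ((H i j)%:R - (G i j)%:R) * z j.
have e0 i j : 0 <= ((H i j)%:R - (G i j)%:R) * z j.
  rewrite mulr_ge0 // subr_ge0; case: (boolP (G i j)) => [/GH ->//|_].
  by rewrite ler0n.
(* The bracket is [A_H z - l z], which is orthogonal to [x] because [H] is symmetric. As [x] is
   positive, its three nonnegative terms all vanish. *)
have S : \sum_i x i * (d i + e i + (m - l) * z i) = 0.
  have -> : \sum_i x i * (d i + e i + (m - l) * z i)
          = \sum_i x i * (\sum_j (H i j)%:R * z j) - \sum_i l * x i * z i.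
    rewrite -sumrB; apply: eq_bigr => i _; rewrite /d /e.
    have -> : \sum_j ((H i j)%:R - (G i j)%:R) * z j
            = \sum_j (H i j)%:R * z j - \sum_j (G i j)%:R * z j.
      by rewrite -sumrB; apply: eq_bigr => j _; rewrite mulrBl.
    ring.
  apply/eqP; rewrite subr_eq0; apply/eqP.
  under eq_bigr do rewrite mulr_sumr.
  rewrite exchange_big; apply: eq_bigr => i _; rewrite -xE mulr_suml.
  by apply: eq_bigr => j _; rewrite symH; ring.
have e'0 i : 0 <= e i by apply: sumr_ge0.
have ml i : 0 <= (m - l) * z i by rewrite mulr_ge0 // subr_ge0.
have t0 i : 0 <= d i + e i + (m - l) * z i by apply: addr_ge0 => //; apply: addr_ge0.
have T i : d i + e i + (m - l) * z i = 0.
  have /eqP := S; rewrite psumr_eq0 => [|j _]; last by rewrite mulr_ge0 // ltW.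
  move=> /allP /(_ i); rewrite mem_index_enum => /(_ isT) /=.
  by rewrite mulf_eq0 (gt_eqF (x0 i)) /= => /eqP.
have di i : d i = 0 by have := T i; have := d0 i; have := e'0 i; have := ml i; lra.
have ei i : e i = 0 by have := T i; have := d0 i; have := e'0 i; have := ml i; lra.
have Hz i : \sum_j (H i j)%:R * z j = m * z i.
  have := ei i; have := di i; rewrite /d /e.
  under [X in _ -> X = 0 -> _]eq_bigr do rewrite mulrBl.
  rewrite sumrB; lra.
have nb i j : z i = 0 -> H i j -> z j = 0.
  move=> zi Hij; have /eqP := Hz i; rewrite zi mulr0 psumr_eq0 => [|u _].
    move=> /allP /(_ j); rewrite mem_index_enum => /(_ isT) /=.
    by rewrite Hij mul1r => /eqP.
  by rewrite mulr_ge0.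
have zn i : z i != 0.
  apply/eqP => zi; case/negP: yk; rewrite -normr_eq0; apply/eqP.
  have zc : z c = 0 by have [<-//|ic] := eqVneq i c; apply: nb zi _; rewrite symH domc.
  by have [->//|kc] := eqVneq k c; apply: nb zc (domc _ kc).
move=> i j; have /eqP := ei i; rewrite psumr_eq0 => [|u _]; last exact: e0.
move=> /allP /(_ j); rewrite mem_index_enum => /(_ isT) /=.
rewrite mulf_eq0 (negPf (zn j)) orbF subr_eq0 eqr_nat.
by case: (H i j) (G i j) => [] [].
Qed.

(* Hong's bound, from the row sums of the squared adjacency matrix. *)
Lemma hong_bound (R : realType) (n : nat) (G : rel 'I_n) (y : 'I_n -> R) (l : R) :
  simple_graph G -> (forall i, 0 < \sum_j G i j)%N -> 0 <= l ->
  (forall i, \sum_j (G i j)%:R * y j = l * y i) -> (exists i, y i != 0) ->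
  l ^+ 2 + n%:R - 1 <= (\sum_i \sum_j G i j)%N%:R.
Proof.
move=> [symG irrG] deg l0 yE [k0 yk0].
pose d i := (\sum_j G i j)%N.
have [k kmax] : exists k, forall i, `|y i| <= `|y k|.
  by case: (@arg_maxP _ _ _ k0 predT (fun i => `|y i|)) => // k _ H; exists k => i; apply: H.
have yk : 0 < `|y k| by apply: lt_le_trans (kmax k0); rewrite normr_gt0.
have B i : l * `|y i| <= (d i)%:R * `|y k|.
  rewrite -{1}[l]ger0_norm // -normrM -yE (le_trans (ler_norm_sum _ _ _)) //.
  rewrite natr_sum mulr_suml; apply: ler_sum => j _.
  by rewrite normrM normr_nat ler_wpM2l.
(* The eigenvector equation is applied twice at [k], where [|y|] is largest: first to [k], then to
   its neighbours through [B]. *)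
have C : l ^+ 2 <= (\sum_j G k j * d j)%N%:R.
  rewrite -(ler_pM2r yk).
  have -> : l ^+ 2 * `|y k| = `|l * (l * y k)| by rewrite !normrM ger0_norm // mulrA.
  rewrite -yE mulr_sumr.
  rewrite (le_trans (ler_norm_sum _ _ _)) // natr_sum mulr_suml; apply: ler_sum => j _.
  rewrite !normrM normr_nat natrM mulrCA -mulrA ler_wpM2l // (ger0_norm l0); exact: B.
(* Outside the neighbours of [k], the degree sum contains [d k] and at least one for each
   nonneighbour other than [k]; together with [k] itself this accounts for [n]. *)
have D : (\sum_j G k j * d j + n <= \sum_j d j + 1)%N.
  have En : (\sum_(j < n) ((j == k) + G k j + ((j != k) && ~~ G k j)) = n)%N.
    rewrite -[RHS]card_ord -sum1_card; apply: eq_bigr => j _.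
    by have [->|] := eqVneq j k; rewrite ?irrG //; case: (G k j).
  rewrite -[X in (_ + X <= _)%N]En !big_split /=.
  have -> : (\sum_(j < n) (j == k) = 1)%N by rewrite (bigD1 k) //= eqxx big1 // => j /negPf ->.
  have : (\sum_j (G k j * d j + (j == k) * d k + ((j != k) && ~~ G k j)) <= \sum_j d j)%N.
    apply: leq_sum => j _; have := deg j; rewrite -/(d j).
    by have [->|] := eqVneq j k; rewrite ?irrG //; case: (G k j); try lia; match goal with |- ?g => idtac g end.
  rewrite !big_split /= [X in (_ + X + _ <= _)%N](bigD1 k) //= eqxx mul1n.
  rewrite [X in (_ + (_ + X) + _ <= _)%N]big1 => [|j /negPf -> //]; rewrite addn0 => D.
  by rewrite -[(1 + _ + _)%N]addnA addnCA addnC leq_add2r addnA.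
have : (\sum_j G k j * d j + n)%N%:R <= (\sum_j d j + 1)%N%:R :> R by rewrite ler_nat.
by rewrite !natrD; move: C; rewrite /d; lra.
Qed.

(** * The extremal graph and its positive eigenvector *)

Lemma Hnb_sym n b : symmetric (Hnb n b).
Proof.
move=> i j; rewrite /Hnb eq_sym; congr (_ && _).
by case: (i < _)%N (j < _)%N => [] [] //=; rewrite andbC.
Qed.

(* The quotient matrix of the partition into [K_(b-1)], [K_1] and [K_(n-b)] has
   the characteristic polynomial [g]: an eigenvector with values
   [l * (l - n + b + 1)], [(b - 1) * (l - n + b + 1)], [(b - 1) * l] on the three parts
   exists for each root [l] of [g], and [g] changes sign on [[n - 2, n - 1]]. *)
Lemma Hnb_positive_eigenvector (R : realType) (n b : nat) :
  (2 <= b)%N -> (b < n)%N ->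
  exists l : R, exists x : 'I_n -> R, [/\ n%:R - 2 <= l, forall i, 0 < x i &
    forall i, \sum_j (Hnb n b i j)%:R * x j = l * x i].
Proof.
move=> b2 bn.
have b2R : 2 <= b%:R :> R by rewrite ler_nat.
have bnR : b%:R + 1 <= n%:R :> R by rewrite natr1 ler_nat.
pose N : R := n%:R; pose B : R := b%:R.
pose u : {poly R} := 'X - (N - B - 1)%:P.
pose g : {poly R} := ('X - (B - 2)%:P) * 'X * u - (B - 1)%:P * u - ((N - B) * (B - 1))%:P * 'X.
have gE t : g.[t] = (t - (B - 2)) * t * (t - (N - B - 1)) - (B - 1) * (t - (N - B - 1)) - (N - B) * (B - 1) * t.
  by rewrite /g /u !(hornerE, hornerD, hornerM, hornerN, hornerC, hornerX).
have [l /andP[l1 l2] /rootP] : exists2 l, N - 2 <= l <= N - 1 & root g l.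
  apply: poly_ivt; first lra.
  apply/andP; split; rewrite gE.
    have -> : (N - 2 - (B - 2)) * (N - 2) * (N - 2 - (N - B - 1)) - (B - 1) * (N - 2 - (N - B - 1)) - (N - B) * (B - 1) * (N - 2) = - (B - 1)^+2 by ring.
    by rewrite oppr_le0 sqr_ge0.
  have -> : (N - 1 - (B - 2)) * (N - 1) * (N - 1 - (N - B - 1)) - (B - 1) * (N - 1 - (N - B - 1)) - (N - B) * (B - 1) * (N - 1) = (N - 1) * N - B * (B - 1) by ring.
  rewrite /N /B; nra.
rewrite gE => gl; exists l.
pose al := l * (l - N + B + 1); pose be := (B - 1) * (l - N + B + 1); pose ga := (B - 1) * l.
pose x (i : 'I_n) := if (i < b.-1)%N then al else if i == b.-1 :> nat then be else ga.
have lN : 0 < l by rewrite /N in l1; lra.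
have l3 : 0 < l - N + B + 1 by rewrite /B; lra.
have B1 : 0 < B - 1 by rewrite /B; lra.
exists x; split => //.
  by move=> i; rewrite /x; case: ifP => _; [|case: ifP => _]; rewrite mulr_gt0.
have tot : \sum_j x j = (B - 1) * al + be + (N - B) * ga.
  rewrite -(big_mkord predT (fun k => if (k < b.-1)%N then al else if k == b.-1 then be else ga)).
  rewrite (big_cat_nat (n := b.-1)) //=; last lia.
  rewrite [X in _ + X = _]big_ltn; last lia.
  rewrite ltnn eqxx prednK ?(ltnW b2) // -addrA; congr (_ + (_ + _)).
  - rewrite (eq_big_nat _ _ (F2 := fun=> al)) => [|k /andP[_ ->]//].
    by rewrite sumr_const_nat subn0 -mulr_natl -subn1 natrB // ltnW.
  - rewrite (eq_big_nat _ _ (F2 := fun=> ga)) => [|k /andP[bk _]].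
      by rewrite sumr_const_nat -mulr_natl natrB // ltnW.
    by rewrite ifF 1?ifF //; lia.
have bo : (b.-1 < n)%N by lia.
pose v := Ordinal bo.
have sum1 (i : 'I_n) : \sum_j (j == i)%:R * x j = x i.
  rewrite (bigD1 i) //= eqxx mul1r big1 ?addr0 // => j /negPf ->.
  by rewrite mul0r.
(* A vertex of [K_(b-1)] misses only itself, one of [K_(n-b)] misses itself and [v], and [v] sees
   only [K_(b-1)]. Only the first kind of row uses [gl]; the other two equations are identities in
   [l]. *)
move=> i; have [ib|ib|ib] := ltngtP i b.-1.
- transitivity (\sum_j x j - \sum_j (j == i)%:R * x j).
    rewrite -sumrB; apply: eq_bigr => j _; rewrite /Hnb ib eq_sym.
    by case: (j == i); rewrite /= ?andbT; ring.
  rewrite sum1 tot /x ib; apply: subr0_eq; rewrite -[RHS]oppr0 -gl /al /be /ga; ring.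
- transitivity (\sum_j x j - \sum_j (j == i)%:R * x j - \sum_j (j == v)%:R * x j).
    rewrite -!sumrB; apply: eq_bigr => j _; rewrite /Hnb eq_sym -!val_eqE /=.
    rewrite ltnNge (ltnW ib) /=.
    have -> : (b <= i)%N by lia.
    have -> : (j < b.-1)%N || (b <= j)%N = (j != b.-1 :> nat) by lia.
    have [ji|ji] := eqVneq (j : nat) i.
      by rewrite ji gtn_eqF //=; ring.
    by case: eqVneq => jb /=; ring.
  rewrite !sum1 tot /x /= ltnn eqxx ltnNge (ltnW ib) /= gtn_eqF // /al /be /ga; ring.
- transitivity ((B - 1) * al).
    rewrite (eq_bigr (fun j : 'I_n => if (j < b.-1)%N then al else 0)).
      rewrite -(big_mkord predT (fun k => if (k < b.-1)%N then al else 0)).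
      rewrite (big_cat_nat (n := b.-1)) //=; last lia.
      rewrite [X in _ + X]big_nat_cond [X in _ + X]big1 => [|k].
        rewrite addr0 (eq_big_nat _ _ (F2 := fun=> al)) => [|k /andP[_ ->]//].
        by rewrite sumr_const_nat subn0 -mulr_natl -subn1 natrB // ltnW.
      by rewrite andbT leqNgt; case: ltnP.
    move=> j _; rewrite /Hnb ib ltnn /= -val_eqE /= ib /x.
    have -> : (b <= b.-1)%N = false by lia.
    rewrite orbF; case: ltnP => jb; rewrite ?andbF ?mul0r //.
    by rewrite andbT gtn_eqF // mul1r.
  by rewrite /x ib ltnn eqxx /al /be; ring.
Qed.

(** * Fractional factors from degree realizations *)

Lemma edges_nat (n : nat) (E : rel 'I_n) (X Y : {set 'I_n}) :
  edges E X Y = (\sum_(i in X) \sum_(j in Y) E i j)%N%:R.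
Proof.
rewrite /edges natr_sum [RHS]big_mkcond; apply: eq_bigr => i _.
case: (i \in X); last by rewrite big1 // => j _; rewrite andbF.
rewrite natr_sum [RHS]big_mkcond; apply: eq_bigr => j _.
by case: (j \in Y); rewrite ?andbT ?andbF.
Qed.

(** Both sides of the bipartite double cover of [G] get the degrees [p]. Symmetry of [G] lets an
    arbitrary pair [(X, Y)] be replaced by the nested pair of its intersection and union, and
    averaging the realization [W] with its transpose gives the weights. *)
Lemma fractional_p_factor_criterion (R : realType) (n : nat) (G : rel 'I_n) (p : 'I_n -> nat) :
  symmetric G ->
  (forall T D : {set 'I_n}, T \subset D ->
     (\sum_(i in T) p i <= \sum_(i in ~: D) p i + \sum_(i in T) \sum_(j in D) G i j)%N) ->
  has_fractional_p_factor R G p.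
Proof.
move=> symG H; pose r (i : 'I_n) : int := (p i)%:R.
have [||W [WG Wr Wc]] := degree_realization G r r => //.
  move=> X Y; pose T := X :&: Y; pose D := X :|: Y.
  have TD : T \subset D by apply: subset_trans (subsetIl _ _) (subsetUl _ _).
  have swap Z Z' : edges G Z Z' = \sum_i \sum_j (G i j && (j \in Z) && (i \in Z'))%:R.
    rewrite /edges exchange_big; apply: eq_bigr => i _; apply: eq_bigr => j _.
    by rewrite symG.
  have e2 : edges G T D + edges G T D <= edges G X Y + edges G X Y.
    rewrite [X in _ + X <= _]swap [X in _ <= _ + X]swap /edges -!big_split; apply: ler_sum => i _ /=.
    rewrite -!big_split; apply: ler_sum => j _ /=; rewrite !inE.
    by case: (G i j) (i \in X) (i \in Y) (j \in X) (j \in Y) => [] [] [] [] [].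
  have e1 : edges G T D <= edges G X Y by lia.
  rewrite /slack; apply: (@le_trans _ _ (edges G T D + \sum_i r i - (\sum_(i in X) r i + \sum_(i in Y) r i))).
    have -> : \sum_(i in X) r i + \sum_(i in Y) r i = \sum_(i in T) r i + \sum_(i in D) r i.
      by rewrite -sum_setUI.
    have -> : \sum_i r i = \sum_(i in D) r i + \sum_(i in ~: D) r i.
      rewrite (bigID (mem D)) /=; by congr (_ + _); apply: eq_bigl => i; rewrite !inE.
    rewrite /r -!natr_sum edges_nat; have := H T D TD; lia.
  by rewrite opprD addrA !lerD2r.
exists (fun i j => ((W i j)%:R + (W j i)%:R) / 2); split; [|split].
- by move=> i j; rewrite addrC.
- by move=> i j; case: (W i j) (W j i) => [] [] /=; lra.
- move=> i.
  have cast (F : 'I_n -> bool) : \sum_j (F j)%:R = (p i)%:R :> int -> \sum_j (F j)%:R = (p i)%:R :> R.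
    by rewrite -!natr_sum => /eqP; rewrite eqr_nat => /eqP ->.
  transitivity (\sum_j ((W i j)%:R + (W j i)%:R) / 2 : R).
    rewrite big_mkcond; apply: eq_bigr => j _.
    case: ifP => // Gij.
    have -> : W i j = false by apply/negP => /WG; rewrite Gij.
    have -> : W j i = false by apply/negP => /WG; rewrite symG Gij.
    by rewrite addr0 mul0r.
  rewrite -mulr_suml big_split /= !cast ?Wr ?Wc //; lra.
Qed.

(** * Embedding into [Hnb] and counting of nonadjacent pairs *)

(** The vertices are listed with the neighbours of [v] first and [v] inserted at position [b.-1].
    All neighbours of [v] then land in [K_(b-1)], and [Hnb] restricts no pair that avoids [v]. *)
Lemma low_degree_embedding (n b : nat) (G : rel 'I_n) (v : 'I_n) :
  simple_graph G -> (0 < b)%N -> (b <= n)%N -> (\sum_j G v j < b)%N ->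
  exists2 f : 'I_n -> 'I_n, bijective f & forall i j, G i j -> Hnb n b (f i) (f j).
Proof.
move=> [symG irrG] b0 bn dv.
have mF (P : pred 'I_n) j : (j \in [seq k <- enum 'I_n | P k]) = P j.
  by rewrite mem_filter mem_enum andbT.
pose A := [seq j <- enum 'I_n | G v j].
pose L := A ++ [seq j <- enum 'I_n | ~~ G v j && (j != v)].
have sA : (size A < b)%N.
  apply: leq_ltn_trans dv; rewrite size_filter -sum1_count big_mkcond /= big_enum /=.
  by apply: leq_sum => j _; case: (G v j).
have Lv : v \notin L by rewrite mem_cat !mF irrG eqxx andbF.
have uL : uniq L.
  rewrite cat_uniq !(filter_uniq _ (enum_uniq _)) andbT -all_predC all_filter.
  by apply/allP => j _ /=; rewrite mem_filter; case: (G v j); rewrite /= ?implybT.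
pose s := take b.-1 L ++ v :: drop b.-1 L.
have ps : perm_eq s (v :: L) by rewrite /s -[v :: drop _ _]cat1s perm_catCA cat_take_drop.
have us : uniq s by rewrite (perm_uniq ps) /= Lv.
have ins i : i \in s.
  rewrite (perm_mem ps) inE mem_cat !mF.
  by case: (G v i); case: eqP.
have ss : size s = n.
  rewrite -[RHS](size_enum_ord n); apply/perm_size/uniq_perm; rewrite ?enum_uniq // => i.
  by rewrite ins mem_enum.
have sL : size L = n.-1 by move: ss; rewrite (perm_size ps) /=; lia.
have st : size (take b.-1 L) = b.-1 by apply: size_takel; lia.
have fn i : (index i s < n)%N by rewrite -[X in (_ < X)%N]ss index_mem.
pose f i := Ordinal (fn i).
have finj : injective f.
  by move=> i j /(congr1 val) /= /(congr1 (nth v s)); rewrite !nth_index.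
have fv : f v = b.-1 :> nat.
  by rewrite /= index_cat (negPf (contra (@mem_take _ _ _ _) Lv)) st /= eqxx addn0.
have fA i : G v i -> (f i < b.-1)%N.
  move=> Gvi; have iA : i \in take b.-1 L.
    rewrite take_cat ifF; last lia.
    by rewrite mem_cat mF Gvi.
  by rewrite /= index_cat iA -[X in (_ < X)%N]st index_mem.
exists f; first exact: injF_bij.
move=> i j Gij; rewrite /Hnb; apply/andP; split.
  by apply/negP => /eqP/finj ij; rewrite ij irrG in Gij.
have [iv|iv] := eqVneq i v; first by rewrite (fA j) ?orbT // -iv.
have [jv|jv] := eqVneq j v; first by rewrite (fA i) // symG -jv.
have nb k : k != v -> f k != b.-1 :> nat by rewrite -fv; apply: contra_neq => /val_inj/finj.
by have := nb i iv; have := nb j jv; lia.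
Qed.

(* The left-hand side counts pairs of distinct vertices in [T * T], [T * (D \ T)] and
   [(D \ T) * T], all of which are nonadjacent except for at most [2 e(T, D)] pairs. *)
Lemma nonadjacent_count (n : nat) (G : rel 'I_n) (T D : {set 'I_n}) :
  simple_graph G -> T \subset D ->
  (\sum_i \sum_j G i j + 2 * (#|T| * #|D :\: T|) + #|T| * #|T| + n <=
   n * n + 2 * (\sum_(i in T) \sum_(j in D) G i j) + #|T|)%N.
Proof.
move=> [symG irrG] /subsetP TD.
have prodE (X Y : {set 'I_n}) : (\sum_i \sum_j ((i \in X) && (j \in Y)) = #|X| * #|Y|)%N.
  rewrite -sum1_card -[#|Y|]sum1_card big_distrl [RHS]big_mkcond; apply: eq_bigr => i _ /=.
  case: (i \in X); last by rewrite big1.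
  by rewrite mul1n [RHS]big_mkcond; apply: eq_bigr => j _; case: (j \in Y).
have diagE (X : {set 'I_n}) : (\sum_(i < n) \sum_(j < n) ((i \in X) && (i == j)) = #|X|)%N.
  rewrite -sum1_card [RHS]big_mkcond; apply: eq_bigr => i _.
  rewrite (bigD1 i) //= eqxx andbT big1; first by case: (i \in X).
  by move=> j /negPf; rewrite eq_sym => ->; rewrite andbF.
have eE : (\sum_(i in T) \sum_(j in D) G i j = \sum_i \sum_j (G i j && (i \in T) && (j \in D)))%N.
  rewrite big_mkcond; apply: eq_bigr => i _.
  case: (i \in T); last by rewrite big1 // => j _; rewrite andbF.
  by rewrite big_mkcond; apply: eq_bigr => j _; case: (j \in D); rewrite ?andbT ?andbF.
have eE' : (\sum_(i in T) \sum_(j in D) G i j = \sum_i \sum_j (G i j && (j \in T) && (i \in D)))%N.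
  by rewrite eE exchange_big; apply: eq_bigr => i _; apply: eq_bigr => j _; rewrite symG.
have nE : (\sum_(i < n) \sum_(j < n) 1 = n * n)%N.
  by under eq_bigr do rewrite sum1_card card_ord; rewrite sum_nat_const card_ord.
have dE : (\sum_(i < n) \sum_(j < n) (i == j) = n)%N.
  transitivity #|[set: 'I_n]|; last by rewrite cardsT card_ord.
  by rewrite -diagE; apply: eq_bigr => i _; apply: eq_bigr => j _; rewrite inE.
have : (\sum_(i < n) \sum_(j < n) (G i j + ((i \in T) && (j \in D :\: T)) + ((i \in D :\: T) && (j \in T))
     + ((i \in T) && (j \in T)) + (i == j)) <=
   \sum_(i < n) \sum_(j < n) (1 + (G i j && (i \in T) && (j \in D)) + (G i j && (j \in T) && (i \in D))
     + ((i \in T) && (i == j))))%N.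
  apply: leq_sum => i _; apply: leq_sum => j _; rewrite !inE.
  have [<-|ij] := eqVneq i j.
    by rewrite irrG; case: (i \in T) (i \in D) => [] [].
  have := TD i; have := TD j.
  by case: (G i j) (i \in T) (i \in D) (j \in T) (j \in D) => [] [] [] [] [] //= h1 h2;
    try (by have := h1 isT); try (by have := h2 isT).
have D2 (F F' : 'I_n -> 'I_n -> nat) :
    (\sum_i \sum_j (F i j + F' i j) = \sum_i \sum_j F i j + \sum_i \sum_j F' i j)%N.
  by rewrite -big_split; apply: eq_bigr => i _; rewrite big_split.
rewrite !D2 !prodE diagE dE nE -eE -eE' mulnC.
set M := (\sum_i _)%N; set e := (\sum_(i in T) _)%N; lia.
Qed.

(** Here [s], [t], [u] are the sizes of [~: D], [T], [D :\: T], and [M] is the degree sum.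
    Eliminating [M] and [e] gives [t <= 2 * b + 2], which bounds [a * s]; the lower bound on [n]
    then forces [u >= 2 * b + 6], and the surviving term [2 * (t - 1) * u] is too large. *)
Lemma counting_contradiction (a b n s t u e M : nat) :
  (0 < a)%N -> (a < b)%N -> (3 * b * (b + a + 1) + 7 * a <= n * a)%N ->
  (n = s + t + u)%N -> (1 < t)%N -> (a * s + e < b * t)%N ->
  (n * n + 3 <= M + 3 * n)%N ->
  (M + 2 * (t * u) + t * t + n <= n * n + 2 * e + t)%N -> False.
Proof.
move=> a0 ab hn nE t1 h1 hM h2.
have {hM}h3 : (2 * (t * u) + t * t + 5 + 2 * (a * s) <= 3 * t + 2 * (b * t) + 2 * s + 2 * u)%N by lia.
have as_ : (s <= a * s)%N by nia.
have t2 : (t <= 2 * b + 2)%N by nia.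
have ua : (a * (2 * b + 6) <= a * u)%N by nia.
have u0 : (2 * b + 6 <= u)%N by rewrite -(leq_pmul2l a0).
case: t t1 {nE h1 h2 t2} h3 => // k k0 h3.
have ku : (k * (2 * b + 6) <= k * u)%N by rewrite leq_mul2l u0 orbT.
have kb : (b <= k * b)%N by rewrite leq_pmull.
lia.
Qed.

Theorem theorem1p8 (R : realType) (a b n : nat) (G : rel 'I_n)
    (rhoG rhoH : R) :
  (1 <= a)%N -> (a < b)%N ->
  simple_graph G ->
  (3%:R * b%:R * (b + a + 1)%N%:R / a%:R + 7%:R : R) <= n%:R ->
  spectral_radius (adjmx R n G) rhoG ->
  spectral_radius (adjmx R n (Hnb n b)) rhoH ->
  rhoH <= rhoG ->
  ~ isomorphic G (Hnb n b) ->
  all_fractional_factors R G a b.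
Proof.
move=> a0 ab sG hn [rG _] [_ rHmax] rHG nI p hp.
have [symG irrG] := sG.
have {hn}hn : (3 * b * (b + a + 1) + 7 * a <= n * a)%N.
  have a0R : 0 < a%:R :> R by rewrite ltr0n.
  move: hn; rewrite -lerBrDr ler_pdivrMr // -(ler_nat R) !(natrD, natrM); lra.
have bn : (b + 7 <= n)%N.
  rewrite -(leq_pmul2l a0); nia.
have [l [x [ln x0 xE]]] := @Hnb_positive_eigenvector R n b ltac:(lia) ltac:(lia).
have n0 : (0 < n)%N by lia.
have lH : l <= rhoH.
  apply: rHmax; apply/(eigenvalue_adjmxP _ _ _ _ (Hnb_sym n b)); exists x => //.
  by exists (Ordinal n0); rewrite gt_eqF.
have /(eigenvalue_adjmxP _ _ _ _ symG) [y yE y0] := rG.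
have lG : l <= rhoG := le_trans lH rHG.
have deg v : (b <= \sum_j G v j)%N.
  rewrite leqNgt; apply/negP => dv; apply: nI.
  have [f fbij fG] := low_degree_embedding n b G v sG (ltnW (leq_ltn_trans a0 ab)) (leq_trans (leq_addr _ _) bn) dv.
  have [g fK gK] := fbij; exists f; split => //.
  (* [Hnb] and its eigenvector are pulled back along [f]. Vertex 0 lies in [K_(b-1)] because
     [b >= 2], so its preimage is a dominating vertex. *)
  apply: (@spectral_monotone_strict R n G (fun i j => Hnb n b (f i) (f j)) (x \o f) y l rhoG (g (Ordinal n0))) => //.
  - by move=> i j; apply: Hnb_sym.
  - move=> i ig; rewrite /Hnb gK eq_sym; apply/andP; split.
      by apply: contra_neq ig => <-; rewrite fK.
    by apply/orP; left => /=; lia.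
  - by move=> i; apply: x0.
  - move=> i; rewrite /= -xE [RHS](reindex f) //=; exact: onW_bij.
have rho0 : 0 <= rhoG.
  have : 7 <= n%:R :> R by rewrite ler_nat; lia.
  lra.
(* From [rhoG >= n - 2], the degree sum is at least [(n - 2)^2 + n - 1 = n^2 - 3 * n + 3]. *)
have M : (n * n + 3 <= \sum_i \sum_j G i j + 3 * n)%N.
  have := hong_bound R n G y rhoG sG (fun i => leq_trans (ltac:(lia) : 0 < b)%N (deg i)) rho0 yE y0.
  have : 7 <= n%:R :> R by rewrite ler_nat; lia.
  rewrite -(ler_nat R) !(natrD, natrM); set m := (\sum_i _)%N%:R; nra.
apply: fractional_p_factor_criterion => // T D TD; rewrite leqNgt; apply/negP => bad.
set e := (\sum_(i in T) _)%N in bad.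
have pT : (\sum_(i in T) p i <= b * #|T|)%N.
  rewrite mulnC -sum_nat_const; apply: leq_sum => i _.
  by have [_ /andP[]] := hp i.
have pS : (a * #|~: D| <= \sum_(i in ~: D) p i)%N.
  rewrite mulnC -sum_nat_const; apply: leq_sum => i _.
  by have [_ /andP[]] := hp i.
have h1 : (a * #|~: D| + e < b * #|T|)%N.
  apply: leq_trans pT; apply: leq_ltn_trans bad; exact: leq_add.
have cards : n = (#|~: D| + #|T| + #|D :\: T|)%N.
  by have := cardsID T D; rewrite (setIidPr TD) -addnA => ->; rewrite addnC cardsC card_ord.
have [t1|t1|t1] := ltngtP #|T| 1.
- by move: h1; rewrite ltnS leqn0 in t1; rewrite (eqP t1) muln0 ltn0.
- by have := counting_contradiction a b n _ _ _ _ _ a0 ab hn cards t1 h1 M (nonadjacent_count n G T D sG TD).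
(* The neighbours of [v] inside [D] number [e] and the others lie in [~: D], so [b <= e + #|~: D|];
   since [a >= 1], this contradicts [h1]. *)
- have /cards1P [v Tv] : #|T| == 1%N by rewrite t1.
  have : (b <= e + #|~: D|)%N.
    apply: leq_trans (deg v) _; rewrite /e Tv big_set1 (bigID (mem D)) /= leq_add2l.
    rewrite -sum1_card; rewrite [leqRHS](eq_bigl (fun i => i \notin D)); last by move=> i; rewrite inE.
    by apply: leq_sum => i _; case: (G v i).
  rewrite t1 muln1 in h1; nia.
Qed.
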